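(* Let $\zeta=\sum_{i=1}^n\zeta_i$ be a $2$-Killing vector field on the multiply warped product manifold $M_1\times_{f_2}M_2\times\cdots\times_{f_n}M_n$, where each $\zeta_i$ is the lift of a vector field on $M_i$ (denoted in the same way). Let $r_i$ be the scalar curvature of $(M_i,g_i)$. Then: (i) $(M_1,g_1,\zeta_1)$ is a hyperbolic Yamabe soliton, with constants $\lambda,\mu\in\mathbb R$ satisfying $\lambda\neq 0$, if and only if there exist $\lambda,\mu\in\mathbb R$ with $\lambda\neq 0$ such that $$\pounds_{\zeta_1}g_1=\frac{\mu-r_1}{\lambda}g_1;$$ (ii) for $2\leq i\leq n$, $(M_i,g_i,\zeta_i)$ is a hyperbolic Yamabe soliton, with constants $\lambda,\mu\in\mathbb R$ satisfying $\lambda f_i^2\neq 2\zeta_1(f_i^2)$ at every point, if and only if there exist $\lambda,\mu\in\mathbb R$ with $\lambda f_i^2\neq 2\zeta_1(f_i^2)$ at every point such that $$\pounds_{\zeta_i}g_i=\frac{(\mu-r_i)f_i^2+\zeta_1(\zeta_1(f_i^2))}{\lambda f_i^2-2\zeta_1(f_i^2)}g_i.$$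
   Context: Let $(M_i,g_i)$, $i\in\{1,\dots,n\}$, be Riemannian manifolds, $M:=M_1\times\dots\times M_n$, and let $\pi_i:M\to M_i$ be the canonical projections. The multiply warped product manifold $M_1\times_{f_2}M_2\times\cdots\times_{f_n}M_n$ is $(M,\bar g)$ with $$\bar g=\pi_1^*(g_1)+\sum_{i=2}^n\left(\pi_1^*(f_i)\right)^2\pi_i^*(g_i),$$ where $f_i:M_1\to(0,\infty)$ is a smooth function, $i\in\{2,\dots,n\}$. The same notation is used for functions and metrics on factor manifolds and for their pullbacks to the product; identities mixing objects from different factors are understood on the product. A vector field $\zeta$ on $(M,\bar g)$ is $2$-Killing if $\pounds_{\zeta}\pounds_{\zeta}\bar g:=\pounds_{\zeta}(\pounds_{\zeta}\bar g)=0$, where $\pounds$ is the Lie derivative. A triple $(N,h,\xi)$, with $(N,h)$ a Riemannian manifold and $\xi$ a smooth vector field on $N$, is a hyperbolic Yamabe soliton with constants $\lambda,\mu\in\mathbb R$ if $\pounds_{\xi}\pounds_{\xi}h+\lambda\pounds_{\xi}h=(\mu-r)h$, where $r$ is the scalar curvature of $(N,h)$. *)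

(* Defs.v *)
From HB Require Import structures.
From mathcomp Require Import all_boot all_order all_algebra.
From mathcomp Require Import all_classical all_reals all_analysis.

Set Implicit Arguments.
Unset Strict Implicit.
Unset Printing Implicit Defensive.

Import Order.TTheory GRing.Theory Num.Theory.
Import numFieldNormedType.Exports.

Local Open Scope classical_set_scope.
Local Open Scope ring_scope.

Fixpoint Ck_on {R : realType} {V W : normedModType R} (k : nat) (U : set V)
    (F : V -> W) : Prop :=
  match k with
  | 0 => forall x, U x -> {for x, continuous F}
  | k'.+1 => (forall x, U x -> differentiable F x) /\
             (forall v : V, Ck_on k' U (fun x => 'D_v F x))
  end.

(* Only meaningful for open U. *)
Definition smooth_on {R : realType} {V W : normedModType R} (U : set V)
    (F : V -> W) : Prop :=
  forall k, Ck_on k U F.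

(* The data of a manifold.  The charts are indexed by [atlas]; [of_coord c] is
   the inverse of the chart [to_coord c], and both maps are total functions,
   meaningless outside [source c] and [target c].  [chart_at] selects a chart
   around each point. *)
Record charted_space (R : realType) := ChartedSpace {
  carrier :> topologicalType ;
  dim : nat ;
  atlas : Type ;
  source : atlas -> set carrier ;
  target : atlas -> set 'rV[R]_dim ;
  to_coord : atlas -> carrier -> 'rV[R]_dim ;
  of_coord : atlas -> 'rV[R]_dim -> carrier ;
  chart_at : carrier -> atlas }.

Arguments source {R c} _.
Arguments target {R c} _.
Arguments to_coord {R c} _ _.
Arguments of_coord {R c} _ _.
Arguments chart_at {R c} _.

Section Manifolds.
Context {R : realType}.

Definition transition (M : charted_space R) (c c' : atlas M) :
    'rV[R]_(dim M) -> 'rV[R]_(dim M) :=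
  fun x => to_coord c' (of_coord c x).

Definition overlap (M : charted_space R) (c c' : atlas M) :
    set 'rV[R]_(dim M) :=
  [set x | target c x /\ source c' (of_coord c x)].

Record smooth_manifold (M : charted_space R) : Prop := SmoothManifold {
  manifold_nonempty : exists p : M, True ;
  manifold_hausdorff : hausdorff_space M ;
  manifold_second_countable : @second_countable M ;
  source_open : forall c : atlas M, open (source c) ;
  target_open : forall c : atlas M, open (target c) ;
  to_coord_target : forall (c : atlas M) p,
    source c p -> target c (to_coord c p) ;
  of_coord_source : forall (c : atlas M) x,
    target c x -> source c (of_coord c x) ;
  to_coordK : forall (c : atlas M) p, source c p ->
    of_coord c (to_coord c p) = p ;
  of_coordK : forall (c : atlas M) x, target c x ->
    to_coord c (of_coord c x) = x ;
  to_coord_continuous : forall (c : atlas M) p,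
    source c p -> {for p, continuous (to_coord c)} ;
  of_coord_continuous : forall (c : atlas M) x,
    target c x -> {for x, continuous (of_coord c)} ;
  chart_at_source : forall p : M, source (chart_at p) p ;
  transition_smooth : forall c c' : atlas M,
    smooth_on (overlap c c') (transition c c') }.

Definition smooth_function (M : charted_space R) (s : M -> R) : Prop :=
  forall c : atlas M, smooth_on (target c) (s \o of_coord c).

(* Vector fields and covariant 2-tensor fields are families of local
   components, one for each chart, as functions of the coordinates; the
   bilinear form [T c x] acts on tangent vectors expressed in the chart c. *)
Definition vfield (M : charted_space R) : Type :=
  atlas M -> 'rV[R]_(dim M) -> 'rV[R]_(dim M).

Definition tensor2 (M : charted_space R) : Type :=
  atlas M -> 'rV[R]_(dim M) -> 'rV[R]_(dim M) -> 'rV[R]_(dim M) -> R.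

(* Components in two charts are related by the Jacobian of the transition. *)
Definition is_vector_field (M : charted_space R) (X : vfield M) : Prop :=
  (forall c, smooth_on (target c) (X c)) /\
  (forall c c' x, overlap c c' x ->
     X c' (transition c c' x) = 'D_(X c x) (transition c c') x).

Record riemannian_metric (M : charted_space R) (g : tensor2 M) : Prop :=
  RiemannianMetric {
  metric_smooth : forall c v w, smooth_on (target c) (fun x => g c x v w) ;
  metric_change : forall c c' x v w, overlap c c' x ->
    g c x v w = g c' (transition c c' x)
                  ('D_v (transition c c') x) ('D_w (transition c c') x) ;
  metric_linear : forall c x w, target c x -> forall (a : R) u v,
    g c x (a *: u + v) w = a * g c x u w + g c x v w ;
  metric_sym : forall c x v w, target c x -> g c x v w = g c x w v ;
  metric_pos : forall c x v, target c x -> v != 0 -> 0 < g c x v v }.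

Definition tensor2_eq (M : charted_space R) (S T : tensor2 M) : Prop :=
  forall c x v w, target c x -> S c x v w = T c x v w.

Definition tensor2_add (M : charted_space R) (S T : tensor2 M) : tensor2 M :=
  fun c x v w => S c x v w + T c x v w.

Definition tensor2_scale (M : charted_space R) (s : M -> R) (T : tensor2 M) :
    tensor2 M :=
  fun c x v w => s (of_coord c x) * T c x v w.

(* The function X(s). *)
Definition vderive (M : charted_space R) (X : vfield M) (s : M -> R) : M -> R :=
  fun p => let c := chart_at p in let x := to_coord c p in
           'D_(X c x) (s \o of_coord c) x.

(* (L_X T)(V,W) = X(T(V,W)) - T([X,V],W) - T(V,[X,W]), evaluated on the fields
   V, W with constant components v, w in the chart, so that [X,V] = - D_v X:
   in coordinates,
   (L_X T)_ab = X^k d_k T_ab + T_kb d_a X^k + T_ak d_b X^k. *)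
Definition lie (M : charted_space R) (X : vfield M) (T : tensor2 M) :
    tensor2 M :=
  fun c x v w =>
    'D_(X c x) (fun y => T c y v w) x
    + T c x ('D_v (X c) x) w + T c x v ('D_w (X c) x).

Definition two_killing (M : charted_space R) (g : tensor2 M) (X : vfield M) :
    Prop :=
  is_vector_field X /\ tensor2_eq (lie X (lie X g)) (fun _ _ _ _ => 0).

Section ScalarCurvature.
Variables (M : charted_space R) (g : tensor2 M).

Let e (i : 'I_(dim M)) : 'rV[R]_(dim M) := delta_mx 0 i.

Definition metric_matrix (c : atlas M) (x : 'rV[R]_(dim M)) :
    'M[R]_(dim M) :=
  \matrix_(i, j) g c x (e i) (e j).

(* Gamma^k_ij *)
Definition christoffel (c : atlas M) (k i j : 'I_(dim M))
    (x : 'rV[R]_(dim M)) : R :=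
  2^-1 * \sum_l invmx (metric_matrix c x) k l *
    ('D_(e i) (fun y => metric_matrix c y j l) x
     + 'D_(e j) (fun y => metric_matrix c y i l) x
     - 'D_(e l) (fun y => metric_matrix c y i j) x).

(* Ric(Y,Z) = tr (X |-> R(X,Y)Z) with
   R(X,Y)Z = D_X D_Y Z - D_Y D_X Z - D_[X,Y] Z, so that the round sphere has
   positive curvature. *)
Definition ricci (c : atlas M) (j k : 'I_(dim M)) (x : 'rV[R]_(dim M)) : R :=
  \sum_i ('D_(e i) (christoffel c i j k) x - 'D_(e j) (christoffel c i i k) x
    + \sum_l (christoffel c i i l x * christoffel c l j k x
              - christoffel c i j l x * christoffel c l i k x)).

Definition scalar_curvature : M -> R :=
  fun p => let c := chart_at p in let x := to_coord c p in
           \sum_j \sum_k invmx (metric_matrix c x) j k * ricci c j k x.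

End ScalarCurvature.

Definition hyperbolic_yamabe_soliton (M : charted_space R) (h : tensor2 M)
    (X : vfield M) (lambda mu : R) : Prop :=
  [/\ smooth_manifold M, riemannian_metric h, is_vector_field X &
      tensor2_eq
        (tensor2_add (lie X (lie X h)) (tensor2_scale (fun=> lambda) (lie X h)))
        (tensor2_scale (fun p => mu - scalar_curvature h p) h)].

(* The product of n + 1 factors, with the product charts; the coordinates of
   the factors are concatenated, the i-th block of x being [submxrow x i]. *)
Definition product_space (n : nat) (M : 'I_n.+1 -> charted_space R) :
    charted_space R :=
  @ChartedSpace R
    (prod_topology (fun i => carrier (M i)))
    (\sum_i dim (M i))
    (forall i, atlas (M i))
    (fun c => [set p | forall i, source (c i) (p i)])
    (fun c => [set x | forall i, target (c i) (submxrow x i)])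
    (fun c p => \mxrow_i to_coord (c i) (p i))
    (fun c x i => of_coord (c i) (submxrow x i))
    (fun p i => chart_at (p i)).

(* pi_i^* T; in product charts d(pi_i) extracts the i-th block. *)
Definition pullback_tensor2 (n : nat) (M : 'I_n.+1 -> charted_space R)
    (i : 'I_n.+1) (T : tensor2 (M i)) : tensor2 (product_space M) :=
  fun c x v w => T (c i) (submxrow x i) (submxrow v i) (submxrow w i).

Definition lift_vfield (n : nat) (M : 'I_n.+1 -> charted_space R)
    (i : 'I_n.+1) (X : vfield (M i)) : vfield (product_space M) :=
  fun c x =>
    \mxrow_j @dfwith _ (fun j => 'rV[R]_(dim (M j))) (fun=> 0) i
               (X (c i) (submxrow x i)) j.

Definition sum_lifts (n : nat) (M : 'I_n.+1 -> charted_space R)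
    (X : forall i, vfield (M i)) : vfield (product_space M) :=
  fun c x => \sum_i lift_vfield (X i) c x.

(* The factors are indexed from 0: the base is M ord0, and [f ord0] is not
   used. *)
Definition warped_metric (n : nat) (M : 'I_n.+1 -> charted_space R)
    (g : forall i, tensor2 (M i)) (f : 'I_n.+1 -> M ord0 -> R) :
    tensor2 (product_space M) :=
  fun c x v w =>
    pullback_tensor2 (g ord0) c x v w
    + \sum_(i | i != ord0)
        tensor2_scale (M := product_space M) (fun p => f i (p ord0) ^+ 2)
          (pullback_tensor2 (g i)) c x v w.

End Manifolds.

(* Main.v *)
Require Import Defs.
From mathcomp Require Import all_boot all_order all_algebra.
From mathcomp Require Import all_classical all_reals all_analysis.
From mathcomp Require Import ring.

Import Order.TTheory GRing.Theory Num.Theory.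
Import numFieldNormedType.Exports.

Set Implicit Arguments.
Unset Strict Implicit.
Unset Printing Implicit Defensive.

Local Open Scope classical_set_scope.
Local Open Scope ring_scope.

(** The Lie derivative of the warped metric along the sum [Z] of the lifted
    fields splits along the factors.  Writing [L_i] for the Lie derivative
    along [zeta i] on the i-th factor, and leaving the projections implicit,
    the Leibniz rule and naturality under the projections give, for a function
    [s] on the base and a 2-tensor [T] on the i-th factor,
    [[
      L_Z (s T) = zeta_0(s) T + s L_i T                          ([lie_warp]).
    ]]
    Applied twice to the terms [g_0] and [f_i^2 g_i] of the metric, this turns
    the vanishing of the second Lie derivative into
    [[
      L_0 L_0 g_0 = 0                                 ([base_two_killing]),
      f_i^2 L_i L_i g_i + 2 zeta_0(f_i^2) L_i g_i
        + zeta_0(zeta_0(f_i^2)) g_i = 0                  ([fibre_identity]).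
    ]]
    Both claims follow by algebra, with the same constants on both sides.  On
    the base the second order term of the soliton equation disappears, and one
    divides by [lambda].  On a fibre one multiplies the soliton equation by
    [f_i^2], eliminates [L_i L_i g_i], and divides by
    [lambda f_i^2 - 2 zeta_0(f_i^2)] ([soliton_ratioP]).

    The terms of the metric are separated by evaluating it on pairs of tangent
    vectors to a single factor ([embed]): all other terms then vanish, and the
    Lie derivative along [Z] respects this restriction because the i-th block
    of [Z] depends only on the coordinates of the i-th factor
    ([block_eq_lie]).

    Two analytic points remain.  The Leibniz rule is needed for [zeta_0(f_i^2)]
    and [L_i g_i], which must thus be shown differentiable in each chart; and
    [vderive], which evaluates in a preferred chart at each point, must agree
    with differentiation in any chart ([vderive_chart]). *)

(** * Differentiability of functions between normed spaces *)

Lemma near_open (T : topologicalType) (U : set T) (x : T) :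
  open U -> U x -> \forall y \near x, U y.
Proof. by move=> oU Ux; exact: open_nbhs_nbhs. Qed.

Section Calculus.
Context {R : realType}.

(** The difference [h - f] vanishes near [a], so its differential is zero. *)
Lemma near_eq_differentiable (V W : normedModType R) (f h : V -> W) (a : V) :
  (\near a, f a = h a) -> differentiable f a -> differentiable h a.
Proof.
move=> fh df.
have near0 : \forall y \near (0 : V), (h - f) (y + a) = 0.
  have fh' : \forall y \near (0 : V), f (y + a) = h (y + a).
    move: fh; rewrite (near_shift 0)/= subr0.
    by apply: filterS => y.
  apply: filterS fh' => y e; rewrite -[LHS]/(h (y + a) - f (y + a)).
  by rewrite e subrr.
have -> : h = f + (h - f) by rewrite addrC subrK.
apply: differentiableD => //.
have dz : (h - f) \o shift a = cst ((h - f) a) + (\0 : V -> W) +o_ (0 : V) id.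
  apply/eqaddoP => _/posnumP[eps]; near=> y.
  have e0 : (h - f) a = 0.
    by move: (nbhs_singleton near0); rewrite add0r.
  have ey : (h - f) (y + a) = 0 by exact: (near near0 y).
  rewrite [X in `|X|](_ : _ = 0) ?normr0 ?mulr_ge0//.
  rewrite -[LHS]/((h - f) (y + a) - ((h - f) a + 0)).
  by rewrite ey e0 addr0 subrr.
have cz : continuous (\0 : V -> W) by exact: cst_continuous.
by apply/diff_locallyP; rewrite (diff_unique cz dz).
Unshelve. all: by end_near. Qed.

Lemma derive_comp (U V W : normedModType R) (G : U -> V) (F : V -> W) x v :
  differentiable G x -> differentiable F (G x) ->
  'D_v (F \o G) x = 'D_('D_v G x) F (G x).
Proof.
move=> dG dF; rewrite !deriveE//; last exact: differentiable_comp.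
by rewrite diff_comp.
Qed.

(** Makes the dependence of a directional derivative on its direction
    explicit, so that it can be differentiated when the direction varies. *)
Lemma derive_coordE (m : nat) (F : 'rV[R]_m -> R) (x v : 'rV[R]_m) :
  differentiable F x ->
  'D_v F x = \sum_k v ord0 k * 'D_(delta_mx ord0 k) F x.
Proof.
move=> dF; rewrite deriveE// {1}(row_sum_delta v) linear_sum/=.
by apply: eq_bigr => k _; rewrite linearZ/= deriveE.
Qed.

Lemma differentiable_entry (V : normedModType R) (m : nat)
    (X : V -> 'rV[R]_m) (x : V) k :
  differentiable X x -> differentiable (fun y => X y ord0 k) x.
Proof.
move=> dX.
exact: (differentiable_comp dX (differentiable_coord (X x) ord0 k)).
Qed.

Lemma differentiable_sum_mul (V : normedModType R) (m : nat)
    (a b : 'I_m -> V -> R) (x : V) :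
  (forall k, differentiable (a k) x) -> (forall k, differentiable (b k) x) ->
  differentiable (fun y => \sum_k a k y * b k y) x.
Proof.
move=> da db.
have -> : (fun y => \sum_k a k y * b k y) = \sum_k (a k * b k).
  by apply/funext => y; rewrite fct_sumE.
by apply: differentiable_sum => k; apply: differentiableM.
Qed.

(** By the expansion in coordinates, a derivative along a variable direction
    is a sum of products of differentiable functions. *)
Lemma differentiable_derive_along (m : nat) (U : set 'rV[R]_m)
    (F : 'rV[R]_m -> R) (X : 'rV[R]_m -> 'rV[R]_m) :
  open U ->
  (forall x, U x -> differentiable F x) ->
  (forall v x, U x -> differentiable (fun y => 'D_v F y) x) ->
  (forall x, U x -> differentiable X x) ->
  forall x, U x -> differentiable (fun y => 'D_(X y) F y) x.
Proof.
move=> oU dF ddF dX x Ux.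
apply: (@near_eq_differentiable _ _
  (fun y => \sum_k X y ord0 k * 'D_(delta_mx ord0 k) F y)).
  near=> y; rewrite derive_coordE//; apply: dF.
  by near: y; exact: open_nbhs_nbhs.
apply: differentiable_sum_mul => k; last exact: ddF.
exact/differentiable_entry/dX.
Unshelve. all: by end_near. Qed.

Lemma smooth_on_differentiable (V W : normedModType R) (U : set V) (F : V -> W)
  x : smooth_on U F -> U x -> differentiable F x.
Proof. by move=> /(_ 1%N)[+ _]; apply. Qed.

Lemma smooth_on_derive_differentiable (V W : normedModType R) (U : set V)
  (F : V -> W) v x :
  smooth_on U F -> U x -> differentiable (fun y => 'D_v F y) x.
Proof. by move=> /(_ 2%N)[_ /(_ v)[+ _]]; apply. Qed.

End Calculus.

(** * Lie derivatives in charts *)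

Section LieDerivative.
Context {R : realType}.
Variables (M : charted_space R).
Implicit Types (S T : tensor2 M) (X : vfield M).

Lemma lie_eq X S T : (forall c : atlas M, open (target c)) ->
  tensor2_eq S T -> tensor2_eq (lie X S) (lie X T).
Proof.
move=> oM ST c x v w cx; rewrite /lie !ST//; congr (_ + _ + _).
apply: near_eq_derive; near=> y; apply: ST.
by near: y; exact: near_open (oM c) cx.
Unshelve. all: by end_near. Qed.

Lemma lie_add X S T c x v w :
  derivable (fun y => S c y v w) x (X c x) ->
  derivable (fun y => T c y v w) x (X c x) ->
  lie X (tensor2_add S T) c x v w = lie X S c x v w + lie X T c x v w.
Proof.
move=> dS dT; rewrite /lie /tensor2_add.
rewrite [X in X + _ + _](deriveD dS dT).
by rewrite [RHS]addrACA; congr (_ + _); rewrite addrACA.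
Qed.

Lemma lie_scale X (s : M -> R) T c x v w :
  derivable (s \o of_coord c) x (X c x) ->
  derivable (fun y => T c y v w) x (X c x) ->
  lie X (tensor2_scale s T) c x v w =
    'D_(X c x) (s \o of_coord c) x * T c x v w
    + s (of_coord c x) * lie X T c x v w.
Proof.
move=> ds dT; rewrite /lie /tensor2_scale.
have -> : 'D_(X c x) (fun y => s (of_coord c y) * T c y v w) x =
    'D_(X c x) (s \o of_coord c) x * T c x v w
    + s (of_coord c x) * 'D_(X c x) (fun y => T c y v w) x.
  by rewrite [LHS](deriveM ds dT) addrC; congr (_ + _); exact: mulrC.
by rewrite !mulrDr !addrA.
Qed.

Lemma near_overlap (c c' : atlas M) x :
  smooth_manifold M -> overlap c c' x -> \forall y \near x, overlap c c' y.
Proof.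
move=> hM [cx cx']; near=> y; split; near: y.
  exact: near_open (@target_open _ _ hM c) cx.
exact: (of_coord_continuous hM cx (near_open (@source_open _ _ hM c') cx')).
Unshelve. all: by end_near. Qed.

(** Independence of the chart: near the point, the two local expressions of
    [s] differ by a transition map, whose derivative carries the components of
    [X] in one chart to those in the other. *)
Lemma vderive_chart X (s : M -> R) (c : atlas M) x :
  smooth_manifold M -> is_vector_field X ->
  (forall (c : atlas M) x, target c x -> differentiable (s \o of_coord c) x) ->
  target c x ->
  vderive X s (of_coord c x) = 'D_(X c x) (s \o of_coord c) x.
Proof.
move=> hM [_ hX] ds cx; rewrite /vderive.
set c' := chart_at _.
have ov : overlap c c' x by split => //; exact: chart_at_source.
rewrite -[to_coord c' _]/(transition c c' x) hX//.
rewrite -derive_comp; last 2 first.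
- exact: smooth_on_differentiable (transition_smooth hM c c') ov.
- by apply: ds; exact: (to_coord_target hM ov.2).
apply: near_eq_derive.
apply: filterS (near_overlap hM ov) => y [_ yc'] /=.
by rewrite /transition (to_coordK hM).
Qed.

(** Chart independence is essential here: the preferred chart may change from
    point to point, so differentiability is only visible once a fixed chart
    is used on a whole neighbourhood. *)
Lemma vderive_differentiable X (s : M -> R) :
  smooth_manifold M -> is_vector_field X ->
  (forall (c : atlas M) x, target c x -> differentiable (s \o of_coord c) x) ->
  (forall (c : atlas M) v x, target c x ->
     differentiable (fun y => 'D_v (s \o of_coord c) y) x) ->
  forall (c : atlas M) x, target c x ->
    differentiable (vderive X s \o of_coord c) x.
Proof.
move=> hM hX ds dds c x cx.
apply: (@near_eq_differentiable _ _ _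
  (fun y => 'D_(X c y) (s \o of_coord c) y)).
  near=> y; rewrite /= vderive_chart//.
  by near: y; exact: near_open (@target_open _ _ hM c) cx.
apply: differentiable_derive_along cx => //.
- exact: target_open.
- exact: ds.
- exact: dds.
- by move=> y; apply/smooth_on_differentiable/hX.1.
Unshelve. all: by end_near. Qed.

Section Metric.
Context (g : tensor2 M).
Hypothesis hg : riemannian_metric g.

Lemma metric0l (c : atlas M) x w : target c x -> g c x 0 w = 0.
Proof.
move=> cx; have := metric_linear hg w cx 1 0 0.
rewrite scale1r addr0 mul1r => e.
by apply: (addIr (g c x 0 w)); rewrite add0r.
Qed.

Lemma metric_coordE (c : atlas M) x v w : target c x ->
  g c x v w = \sum_k v ord0 k * g c x (delta_mx ord0 k) w.
Proof.
move=> cx; rewrite {1}(row_sum_delta v).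
elim/big_rec2: _ => [|k a u _ <-]; first exact: metric0l.
exact: metric_linear.
Qed.

(** In coordinates the Lie derivative is a sum of products of
    components of [g] and [X] and their first derivatives. *)
Lemma lie_metric_differentiable X (c : atlas M) x v w :
  smooth_manifold M -> is_vector_field X -> target c x ->
  differentiable (fun y => lie X g c y v w) x.
Proof.
move=> hM hX; have oc := @target_open _ _ hM c; move: x.
have dX y : target c y -> differentiable (X c) y.
  exact/smooth_on_differentiable/hX.1.
have dg v' w' y : target c y -> differentiable (fun y => g c y v' w') y.
  exact/smooth_on_differentiable/(metric_smooth hg).
have dgD v' w' y : target c y ->
    differentiable (fun y => g c y ('D_v' (X c) y) w') y.
  move=> cy; apply: (@near_eq_differentiable _ _ _
    (fun y => \sum_k ('D_v' (X c) y) ord0 k * g c y (delta_mx ord0 k) w')).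
    near=> z; rewrite -metric_coordE//.
    by near: z; exact: near_open oc cy.
  apply: differentiable_sum_mul => k; last exact: dg.
  apply/differentiable_entry.
  exact: (smooth_on_derive_differentiable _ (hX.1 c)).
move=> x cx; apply: differentiableD; first apply: differentiableD.
- apply: differentiable_derive_along cx => //; first by move=> y; exact: dg.
  move=> u y; exact/smooth_on_derive_differentiable/(metric_smooth hg).
- exact: dgD.
(* symmetry reduces the last term to the previous one *)
- apply: near_eq_differentiable (dgD w v _ cx).
  near=> y; apply: (Defs.metric_sym hg).
  by near: y; exact: near_open oc cx.
Unshelve. all: by end_near. Qed.

End Metric.
End LieDerivative.

(** * Block decomposition of coordinates *)

Section Blocks.
Context {R : realType} {n : nat} {d : 'I_n.+1 -> nat}.
Local Notation block i := (fun x : 'rV[R]_(\sum_j d j) => submxrow x i).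

Lemma submxrowZD i (a : R) (x y : 'rV[R]_(\sum_j d j)) :
  submxrow (a *: x + y) i = a *: submxrow x i + submxrow y i.
Proof. by apply/matrixP => k l; rewrite !mxE. Qed.

Lemma submxrow_continuous i : continuous (block i).
Proof.
move=> x s /= /(nbhs_ballP (submxrow x i)) [e e0 es].
apply/nbhs_ballP; exists e => //= y [_ xy]; apply: es; split => // k l.
by rewrite !mxE; exact: xy.
Qed.

Section Pullback.
Context {W : normedModType R} (i : 'I_n.+1) (F : 'rV[R]_(d i) -> W).

(** Projecting to a block is linear, so the difference quotients agree exactly,
    before any limit is taken. *)
Lemma pullback_quotient x v :
  (fun h => h^-1 *:
    (((F \o block i) \o shift x) (h *: v) - (F \o block i) x)) =
  (fun h => h^-1 *:
    ((F \o shift (block i x)) (h *: block i v) - F (block i x))).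
Proof. by apply/funext => h /=; rewrite submxrowZD. Qed.

Lemma derivable_pullback x v :
  derivable F (submxrow x i) (submxrow v i) -> derivable (F \o block i) x v.
Proof. by rewrite /derivable pullback_quotient. Qed.

Lemma derive_pullback x v :
  'D_v (F \o block i) x = 'D_(submxrow v i) F (submxrow x i).
Proof. by rewrite /derive pullback_quotient. Qed.

End Pullback.

(** The Jacobian of a product map is block diagonal. *)
Lemma derive_submxrow (F : forall j, 'rV[R]_(d j) -> 'rV[R]_(d j)) x v j :
  (forall k, differentiable (F k) (submxrow x k)) ->
  submxrow ('D_v (fun y => \mxrow_k F k (submxrow y k)) x) j =
  'D_(submxrow v j) (F j) (submxrow x j).
Proof.
move=> dF.
have dFk k : derivable (F k \o block k) x v.
  exact/derivable_pullback/diff_derivable.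
(* a matrix-valued derivative is computed entrywise once it exists *)
rewrite derive_mx; last first.
  apply/derivable_mxP => a b.
  under [X in derivable X]eq_fun do rewrite mxE.
  exact: (derivable_mxP _ _ _).1 (dFk _) a _.
rewrite -derive_pullback derive_mx//.
apply/matrixP => a b; rewrite !mxE; congr ('D_v _ x).
apply/funext => y.
by have /matrixP/(_ a b) := mxrowK (fun k => F k (submxrow y k)) j; rewrite mxE.
Qed.

(** The inclusion of the tangent space of the i-th factor into that of the
    product; by definition it also builds the components of a lifted field. *)
Definition embed i (v : 'rV[R]_(d i)) : 'rV[R]_(\sum_j d j) :=
  \mxrow_j @dfwith _ (fun j => 'rV[R]_(d j)) (fun=> 0) i v j.

Lemma embedK i (v : 'rV[R]_(d i)) : submxrow (embed v) i = v.
Proof. by rewrite mxrowK dfwithin. Qed.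

Lemma submxrow_embed i j (v : 'rV[R]_(d i)) :
  i != j -> submxrow (embed v) j = 0.
Proof. by move=> ij; rewrite mxrowK dfwithout. Qed.

Lemma embedP i (v : 'rV[R]_(d i)) x :
  submxrow x i = v -> (forall j, i != j -> submxrow x j = 0) -> x = embed v.
Proof.
move=> xi xj; apply/mxrowP => j; case: (eqVneq i j) => [<-|ij].
  by rewrite embedK.
by rewrite xj// submxrow_embed.
Qed.

End Blocks.

(** * The Lie derivative on a product *)

Section Product.
Context {R : realType} {n : nat} (M : 'I_n.+1 -> charted_space R).
Hypothesis hM : forall i, smooth_manifold (M i).
Let P := product_space M.

Lemma product_target_open (c : atlas P) : open (target c).
Proof.
rewrite openE => x cx.
have : \forall y \near x, forall i, target (c i) (submxrow y i).
  apply: (@filter_forall _ _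
    (fun i y => target (c i) (submxrow y i)) (nbhs x)) => i.
  exact: (@submxrow_continuous _ _ _ i x _
    (near_open (@target_open _ _ (hM i) (c i)) (cx i))).
by [].
Qed.

(** Descends identities from the product to one factor; this is where the
    other factors must be nonempty. *)
Lemma product_extend i (ci : atlas (M i)) (xi : 'rV[R]_(Defs.dim (M i))) :
  target ci xi ->
  exists (c : atlas P) (x : 'rV[R]_(Defs.dim P)),
    [/\ target c x, c i = ci & submxrow x i = xi].
Proof.
move=> cx.
pose p j := sval (cid (manifold_nonempty (hM j))).
exists (@dfwith _ (fun j => atlas (M j)) (fun j => chart_at (p j)) i ci).
exists (\mxrow_j @dfwith _ (fun j => 'rV[R]_(Defs.dim (M j)))
  (fun j => to_coord (chart_at (p j)) (p j)) i xi j).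
split; [|by rewrite dfwithin|by rewrite mxrowK dfwithin].
move=> j; rewrite mxrowK; case: (eqVneq i j) => [<-|ij].
  by rewrite !dfwithin.
rewrite !dfwithout//; apply: (to_coord_target (hM j)).
exact: chart_at_source.
Qed.

Section Lifts.
Context (zeta : forall i, vfield (M i)).
Arguments zeta : clear implicits.
Hypothesis hzeta : forall i, is_vector_field (zeta i).
Let Z : vfield P := sum_lifts zeta.

Lemma sum_liftsE (c : atlas P) x :
  Z c x = \mxrow_j zeta j (c j) (submxrow x j).
Proof.
apply/mxrowP => j; rewrite mxrowK /Z /sum_lifts.
have -> : submxrow (\sum_i lift_vfield (zeta i) c x) j =
          \sum_i submxrow (lift_vfield (zeta i) c x) j.
  elim/big_ind2: _ => [|a b u w <- <-|//].
    by apply/matrixP => k l; rewrite !mxE.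
  by apply/matrixP => k l; rewrite !mxE.
rewrite (bigD1 j)//= big1 ?addr0; first exact: embedK.
by move=> k kj; exact: submxrow_embed.
Qed.

Lemma submxrow_sum_lifts (c : atlas P) x j :
  submxrow (Z c x) j = zeta j (c j) (submxrow x j).
Proof. by rewrite sum_liftsE mxrowK. Qed.

Lemma derive_sum_lifts (c : atlas P) x v j : target c x ->
  submxrow ('D_v (Z c) x) j = 'D_(submxrow v j) (zeta j (c j)) (submxrow x j).
Proof.
move=> cx; rewrite (_ : Z c = fun y => \mxrow_k zeta k (c k) (submxrow y k)).
  apply: (derive_submxrow (F := fun k => zeta k (c k))) => k.
  exact: smooth_on_differentiable ((hzeta k).1 (c k)) (cx k).
by apply/funext => y; exact: sum_liftsE.
Qed.

Lemma derive_sum_lifts_embed (c : atlas P) x i (v : 'rV[R]_(Defs.dim (M i))) :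
  target c x ->
  'D_(embed v) (Z c) x = embed ('D_v (zeta i (c i)) (submxrow x i)).
Proof.
move=> cx; apply: embedP => [|j ij]; rewrite derive_sum_lifts//.
  by rewrite embedK.
by rewrite submxrow_embed// derive0.
Qed.

(** Naturality of the Lie derivative: [Z] projects to [zeta i]. *)
Lemma lie_pullback i (T : tensor2 (M i)) :
  tensor2_eq (lie Z (pullback_tensor2 T))
             (pullback_tensor2 (lie (zeta i) T)).
Proof.
move=> c x v w cx; rewrite /lie /pullback_tensor2 !derive_sum_lifts//.
congr (_ + _ + _).
rewrite -submxrow_sum_lifts.
exact: (derive_pullback (fun y => T (c i) y (submxrow v i) (submxrow w i))).
Qed.

(** Weaker than [tensor2_eq]: the warped metric agrees with its i-th term only
    on vectors tangent to the i-th factor. *)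
Definition block_eq i (S T : tensor2 P) : Prop :=
  forall (c : atlas P) x (v w : 'rV[R]_(Defs.dim (M i))), target c x ->
    S c x (embed v) (embed w) = T c x (embed v) (embed w).

(** The bracket of [Z] with a field tangent to the i-th factor is again tangent
    to it, so only the restrictions of the tensors enter. *)
Lemma block_eq_lie i (S T : tensor2 P) :
  block_eq i S T -> block_eq i (lie Z S) (lie Z T).
Proof.
move=> ST c x v w cx; rewrite /lie !derive_sum_lifts_embed// !ST//.
congr (_ + _ + _); apply: near_eq_derive; near=> y; apply: ST.
by near: y; exact: near_open (@product_target_open c) cx.
Unshelve. all: by end_near. Qed.

Definition warp i (s : M ord0 -> R) (T : tensor2 (M i)) : tensor2 P :=
  tensor2_scale (M := P) (fun p => s (p ord0)) (pullback_tensor2 T).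

Section Warp.
Context (i : 'I_n.+1) (s : M ord0 -> R) (T : tensor2 (M i)).
Hypothesis ds : forall (c : atlas (M ord0)) x,
  target c x -> differentiable (s \o of_coord c) x.
Hypothesis dT : forall c v w x,
  target c x -> differentiable (fun y => T c y v w) x.

Lemma derivable_base (c : atlas P) x v : target c x ->
  derivable ((fun p : P => s (p ord0)) \o of_coord c) x v.
Proof.
move=> cx; apply: (derivable_pullback (F := s \o of_coord (c ord0))).
exact/diff_derivable/ds/cx.
Qed.

Lemma derivable_pullback_tensor (c : atlas P) x v w u : target c x ->
  derivable (fun y => pullback_tensor2 T c y v w) x u.
Proof.
move=> cx.
apply: (derivable_pullback
  (F := fun y => T (c i) y (submxrow v i) (submxrow w i))).
exact/diff_derivable/dT/cx.
Qed.

Lemma derivable_warp (c : atlas P) x v w u : target c x ->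
  derivable (fun y => warp s T c y v w) x u.
Proof.
move=> cx; apply: derivableM; first exact: derivable_base.
exact: derivable_pullback_tensor.
Qed.

(** The Leibniz rule, in which [Z] differentiates a function of the base point
    through its base component alone. *)
Lemma lie_warp :
  tensor2_eq (lie Z (warp s T))
    (tensor2_add (warp (vderive (zeta ord0) s) T) (warp s (lie (zeta i) T))).
Proof.
move=> c x v w cx; rewrite lie_scale; last 2 first.
- exact: derivable_base.
- exact: derivable_pullback_tensor.
rewrite lie_pullback//; congr (_ * _ + _).
rewrite (derive_pullback (s \o of_coord (c ord0))) submxrow_sum_lifts.
by rewrite -vderive_chart.
Qed.

End Warp.

(** * Consequences of the 2-Killing equation *)

Section TwoKilling.
Context (g : forall i, tensor2 (M i)) (f : 'I_n.+1 -> M ord0 -> R).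
Arguments g : clear implicits.
Hypothesis hg : forall i, riemannian_metric (g i).
Hypothesis hf : forall i, i != ord0 -> smooth_function (f i).
Hypothesis hZ : two_killing (warped_metric g f) Z.

Lemma block_warped_base :
  block_eq ord0 (warped_metric g f) (pullback_tensor2 (g ord0)).
Proof.
move=> c x v w cx; rewrite /warped_metric big1 ?addr0// => j j0.
rewrite /tensor2_scale /pullback_tensor2 submxrow_embed 1?eq_sym//.
by rewrite (metric0l (hg j))// mulr0.
Qed.

Lemma block_warped_fibre i : i != ord0 ->
  block_eq i (warped_metric g f) (warp (fun q => f i q ^+ 2) (g i)).
Proof.
move=> i0 c x v w cx; rewrite /warped_metric {1}/pullback_tensor2.
rewrite submxrow_embed// (metric0l (hg ord0))// add0r.
rewrite (bigD1 i)//= big1 ?addr0// => j /andP[_ ji].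
rewrite /tensor2_scale /pullback_tensor2 submxrow_embed 1?eq_sym//.
by rewrite (metric0l (hg j))// mulr0.
Qed.

Lemma base_two_killing :
  tensor2_eq (lie (zeta ord0) (lie (zeta ord0) (g ord0))) (fun _ _ _ _ => 0).
Proof.
move=> c0 x0 v w /product_extend[c [x [cx <- <-]]].
have := hZ.2 c x (embed v) (embed w) cx.
rewrite (block_eq_lie (block_eq_lie block_warped_base))//.
rewrite (lie_eq Z product_target_open (lie_pullback (g ord0)) _ _ cx).
rewrite (lie_pullback _ _ _ cx).
by rewrite /pullback_tensor2 !embedK.
Qed.

(** The factor 2 collects the two ways of letting one Lie derivative act on
    [f_i^2] and the other on [g_i]. *)
Lemma fibre_identity i : i != ord0 ->
  let f2 := fun q => f i q ^+ 2 in
  let zf2 := vderive (zeta ord0) f2 in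
  let zzf2 := vderive (zeta ord0) zf2 in
  forall (c : atlas P) x v w, target c x ->
  let q := of_coord (c ord0) (submxrow x ord0) in
  let y := submxrow x i in
  f2 q * lie (zeta i) (lie (zeta i) (g i)) (c i) y v w
  + 2 * zf2 q * lie (zeta i) (g i) (c i) y v w
  + zzf2 q * g i (c i) y v w = 0.
Proof.
move=> i0 f2 zf2 zzf2 c x v w cx q y.
have df c0 z : target c0 z -> differentiable (f i \o of_coord c0) z.
  exact/smooth_on_differentiable/(hf i0).
have df2 c0 z : target c0 z -> differentiable (f2 \o of_coord c0) z.
  move=> cz; exact: (differentiableM (df _ _ cz) (df _ _ cz)).
have ddf2 c0 u z : target c0 z ->
    differentiable (fun y => 'D_u (f2 \o of_coord c0) y) z.
  move=> cz; apply: (@near_eq_differentiable _ _ _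
    ((f i \o of_coord c0) * (fun y => 'D_u (f i \o of_coord c0) y) *+ 2)).
    near=> y0.
    have cy0 : target c0 y0.
      by near: y0; exact: near_open (@target_open _ _ (hM _) c0) cz.
    rewrite -[RHS]/('D_u ((f i \o of_coord c0) * (f i \o of_coord c0)) y0).
    rewrite deriveM; [|exact/diff_derivable/df..].
    by [].
  rewrite mulr2n; apply: differentiableD; apply: differentiableM; try exact: df;
  exact: smooth_on_derive_differentiable (hf i0 c0) cz.
have dzf2 : forall c0 z, target c0 z -> differentiable (zf2 \o of_coord c0) z.
  exact: vderive_differentiable.
have dg c0 u u' z : target c0 z -> differentiable (fun y => g i c0 y u u') z.
  exact/smooth_on_differentiable/(metric_smooth (hg i)).
have dL c0 u u' z : target c0 z ->
    differentiable (fun y => lie (zeta i) (g i) c0 y u u') z.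
  exact: lie_metric_differentiable.
have := hZ.2 c x (embed v) (embed w) cx.
rewrite (block_eq_lie (block_eq_lie (block_warped_fibre i0)))//.
rewrite (lie_eq Z product_target_open (lie_warp df2 dg) _ _ cx).
rewrite lie_add; [|exact: derivable_warp..].
rewrite !lie_warp//.
rewrite /tensor2_add /warp /tensor2_scale /pullback_tensor2 !embedK => <-.
rewrite -/q -/y -/zf2 -/zzf2 -/f2.
ring.
Unshelve. all: by end_near. Qed.

End TwoKilling.
End Lifts.
End Product.

(** * From the 2-Killing identities to solitons *)

(** With [LL] and [L] the second and first Lie derivatives of [G]: multiplying
    the soliton equation by [F] and subtracting the 2-Killing identity
    leaves a linear equation for [L] alone. *)
Lemma soliton_ratioP (K : fieldType) (F a b lambda m G L LL : K) :
  F != 0 -> lambda * F != 2 * a -> F * LL + 2 * a * L + b * G = 0 ->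
  LL + lambda * L = m * G <->
  L = (m * F + b) / (lambda * F - 2 * a) * G.
Proof.
move=> F0; rewrite -[_ == 2 * a]subr_eq0; set D := _ - _ => D0 e.
have key : F * (LL + lambda * L - m * G) = D * L - (m * F + b) * G.
  by apply/eqP; rewrite -subr_eq0 -e /D; apply/eqP; ring.
have -> : (LL + lambda * L = m * G) <-> D * L = (m * F + b) * G.
  split=> /eqP; rewrite -subr_eq0.
    by move=> /eqP sol; apply/eqP; rewrite -subr_eq0 -key sol mulr0.
  by rewrite -key mulf_eq0 (negPf F0) subr_eq0 => /eqP.
split=> [DL|->]; first by rewrite mulrAC -DL mulrAC divff// mul1r.
by rewrite mulrA [D * _]mulrC divfK.
Qed.

Theorem proposition4p2 (R : realType) (n : nat)
    (M : 'I_n.+1 -> charted_space R)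
    (g : forall i : 'I_n.+1, tensor2 (M i))
    (f : 'I_n.+1 -> M ord0 -> R)
    (zeta : forall i : 'I_n.+1, vfield (M i))
    (hM : forall i, smooth_manifold (M i))
    (hg : forall i, riemannian_metric (g i))
    (hf : forall i, i != ord0 -> smooth_function (f i))
    (hf_pos : forall i, i != ord0 -> forall q, 0 < f i q)
    (hzeta : forall i, is_vector_field (zeta i))
    (hkilling : two_killing (warped_metric g f) (sum_lifts zeta)) :
  (* (i) *)
  ((exists lambda mu : R, lambda != 0 /\
      hyperbolic_yamabe_soliton (g ord0) (zeta ord0) lambda mu)
   <->
   (exists lambda mu : R, lambda != 0 /\
      tensor2_eq (lie (zeta ord0) (g ord0))
        (tensor2_scale
           (fun q => (mu - scalar_curvature (g ord0) q) / lambda) (g ord0))))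
  /\
  (* (ii) *)
  (forall i : 'I_n.+1, i != ord0 ->
   let f2 : M ord0 -> R := fun q => f i q ^+ 2 in
   let zf2 : M ord0 -> R := vderive (zeta ord0) f2 in
   let zzf2 : M ord0 -> R := vderive (zeta ord0) zf2 in
   (exists lambda mu : R, (forall q, lambda * f2 q != 2 * zf2 q) /\
      hyperbolic_yamabe_soliton (g i) (zeta i) lambda mu)
   <->
   (exists lambda mu : R, (forall q, lambda * f2 q != 2 * zf2 q) /\
      tensor2_eq
        (pullback_tensor2 (lie (zeta i) (g i)))
        (tensor2_scale (M := product_space M)
           (fun p => ((mu - scalar_curvature (g i) (p i)) * f2 (p ord0)
                      + zzf2 (p ord0))
                     / (lambda * f2 (p ord0) - 2 * zf2 (p ord0)))
           (pullback_tensor2 (g i))))).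
Proof.
split.
  have L0 := base_two_killing hM hzeta hg hkilling.
  split=> -[la [mu [la0 H]]]; exists la, mu; split=> //.
    case: H => _ _ _ H c x v w cx.
    have := H c x v w cx; rewrite /tensor2_add L0// add0r /tensor2_scale => e.
    by rewrite mulrAC -e mulrC mulKf.
  split=> // c x v w cx.
  rewrite /tensor2_add L0// add0r /tensor2_scale H// /tensor2_scale.
  by rewrite mulrA [la * _]mulrC divfK.
move=> i i0 f2 zf2 zzf2.
have f2_neq0 q : f2 q != 0 by rewrite expf_neq0// gt_eqF// hf_pos.
have K := fibre_identity hM hzeta hg hf hkilling i0.
split=> -[la [mu [la_neq H]]]; exists la, mu; split=> //.
  case: H => _ _ _ H c x v w cx.
  apply/(soliton_ratioP _ (f2_neq0 _) (la_neq _) (K c x _ _ cx)).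
  exact: (H (c i) (submxrow x i) _ _ (cx i)).
(* any point of the base over the given point of the fibre will do *)
split=> // ci xi v w /(product_extend hM)[c [x [cx <- <-]]].
apply/(soliton_ratioP _ (f2_neq0 _) (la_neq _) (K c x _ _ cx)).
have := H c x (embed v) (embed w) cx.
by rewrite /tensor2_scale /pullback_tensor2 !embedK.
Qed.
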